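(* Let $n\ge 1$ be an integer. For real numbers $a_1,\dots,a_n$ put $$C(t)=\sum_{j=1}^{n}a_j\cos jt,\qquad S(t)=\sum_{j=1}^{n}a_j\sin jt .$$ Let $$J_1=\sup_{(a_1,\dots,a_n)\in\mathbb R^n,\ \sum_{j=1}^n a_j=1}\ \min_{t}\left\{C(t):\ S(t)=0\right\},$$ where the minimum is over all real $t$ with $S(t)=0$. Then $$J_1=-\tan^2\frac{\pi}{2(n+1)} .$$ *)

(* Defs.v *)
From mathcomp Require Import all_boot all_order all_algebra.
From mathcomp Require Import all_classical all_reals all_analysis.

Set Implicit Arguments.
Unset Strict Implicit.
Unset Printing Implicit Defensive.

Import Order.TTheory GRing.Theory Num.Theory.

Local Open Scope classical_set_scope.
Local Open Scope ring_scope.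

(* The coefficient a_j is stored at index j - 1 of the row vector [a]. *)
Definition trigC (R : realType) (n : nat) (a : 'rV[R]_n) (t : R) : R :=
  \sum_(j < n) a ord0 j * cos (j.+1%:R * t).

Definition trigS (R : realType) (n : nat) (a : 'rV[R]_n) (t : R) : R :=
  \sum_(j < n) a ord0 j * sin (j.+1%:R * t).

Definition is_min (R : realType) (A : set R) (m : R) : Prop :=
  A m /\ lbound A m.

Definition C_on_zeros_of_S (R : realType) (n : nat) (a : 'rV[R]_n) : set R :=
  [set trigC a t | t in [set t | trigS a t = 0]].

(* Taken in the extended reals, so that no default value is involved.  The
   relation [is_min] would discard an [a] for which the minimum is not
   attained; existence of the minimum therefore has to be claimed alongside
   any statement about [J1]. *)
Definition J1 (R : realType) (n : nat) : \bar R :=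
  ereal_sup [set m%:E | m in
    [set m : R | exists a : 'rV[R]_n,
       \sum_(j < n) a ord0 j = 1 /\ is_min (C_on_zeros_of_S a) m]].

(* Main.v *)
Require Import Defs.
From mathcomp Require Import all_boot all_order all_algebra.
From mathcomp Require Import all_classical all_reals all_analysis.
From mathcomp Require Import ring lra zify.

Import Order.TTheory GRing.Theory Num.Theory.

Local Open Scope ring_scope.

(* Put alpha = pi / (n + 1) and c = cos alpha, so that
   tan^2 (alpha / 2) = (1 - c) / (1 + c).  In the variable x = cos t the
   polynomial W = sin t * S(t) = (1 - x^2) P(x) has degree at most n + 1, and
   the zeros of S are the roots of W in [-1, 1].  Let E be the average over the
   nodes cos ((2k + 1) alpha), 0 <= k <= n; it kills the Chebyshev polynomials
   T_1, ..., T_n, and all the nodes are at most c.  At a root x of W the value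
   of C is E [W(y) / (x - y)].

   Upper bound: taking out the sign changes of W, write
   W = - prod_j (z_j - y) q(y) with 1 = z_0 > ... > z_m >= -1 and q >= 0 on
   [-1, 1].  There are r_k in [z_k, z_(k-1)] such that T = prod_k (r_k - y) is
   nonnegative for y <= c: below c they are taken in equal pairs.  By
   interlacing, T / prod_j (z_j - y) = sum_i mu_i / (z_i - y) with mu_i >= 0 of
   sum 1, hence sum_i mu_i C(z_i) = - E [q T] <= 0.  As C(z_0) = C(1) = 1 and
   mu_0 >= (1 - c) / 2, some other C(z_i) is at most - (1 - c) / (1 + c).

   Lower bound: with b_k = sin ((k + 1) alpha), Fejer's nonnegative polynomial
   P = |sum_k b_k e^(ikt)|^2 gives C(pi) / C(0) = - (1 - c) / (1 + c), but C is
   smaller at the double zeros of P in (0, pi).  Adding eps to P removes these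
   zeros, and eps tends to 0. *)

(** * Interlacing points *)

(** Induction on [m]: since [z m.+1 <= r m <= z i] for [i <= m], the new factor [r m - y] is a
    convex combination of [z m.+1 - y] and [z i - y]. In the term of index [i], the first part keeps
    the omitted index [i], while the second fills the gap and passes its weight to the index
    [m.+1]. *)
Lemma interlacing_weights {R : realFieldType} (z r : nat -> R) (m : nat) :
  (forall i j, (i < j <= m)%N -> z j < z i) ->
  (forall k, (k < m)%N -> z k.+1 <= r k <= z k) ->
  exists mu : nat -> R,
    [/\ forall i, 0 <= mu i,
        \sum_(i < m.+1) mu i = 1,
        forall y, \prod_(k < m) (r k - y) =
          \sum_(i < m.+1) mu i * \prod_(j < m.+1 | j != i :> nat) (z j - y)
      & mu 0%N = \prod_(k < m) ((z 0%N - r k) / (z 0%N - z k.+1))].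
Proof.
elim: m => [|m IH] zdec zr.
  exists (fun=> 1); split => [//|||]; rewrite ?big_ord1 ?big_ord0 //.
  by move=> y; rewrite big_ord0 big_ord1 big_pred0 ?mulr1 // => -[[|]].
have [||mu [mu_ge0 mu_sum mu_prod mu0]] := IH.
- by move=> i j /andP[ij jm]; apply: zdec; rewrite ij leqW.
- by move=> k km; apply: zr; rewrite ltnW.
(* [w i] is the weight of [z m.+1] in [r m = w i * z m.+1 + (1 - w i) * z i]. *)
pose w i := (z i - r m) / (z i - z m.+1).
have zltm i : (i <= m)%N -> z m.+1 < z i by move=> im; apply: zdec; rewrite ltnS im leqnn.
have zlem i : (i <= m)%N -> z m <= z i.
  by rewrite leq_eqVlt => /predU1P[->//|im]; apply/ltW/zdec; rewrite im leqnSn.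
have /andP[zr1 zr2] := zr m (leqnn _).
have w01 i : (i <= m)%N -> 0 <= w i <= 1.
  move=> im; have := zltm i im; have := zlem i im => h1 h2.
  by rewrite /w divr_ge0 ?ler_pdivrMr ?mul1r /=; lra.
exists (fun i => if (i <= m)%N then mu i * w i
                 else \sum_(i < m.+1) mu i * (1 - w i)); split.
- move=> i; case: ifPn => [im|_]; first by rewrite mulr_ge0 //; case/andP: (w01 i im).
  apply: sumr_ge0 => j _; rewrite mulr_ge0 // subr_ge0.
  by case/andP: (w01 j (ltn_ord j)).
- rewrite big_ord_recr /= ltnn; under eq_bigr => i _ do rewrite -ltnS ltn_ord.
  rewrite -big_split /= -[RHS]mu_sum; apply: eq_bigr => i _; ring.
- move=> y; rewrite big_ord_recr /= mu_prod [RHS]big_ord_recr /= ltnn !mulr_suml -big_split /=.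
  apply: eq_bigr => i _; rewrite -ltnS ltn_ord.
  have -> : \prod_(j < m.+2 | j != m.+1 :> nat) (z j - y) =
            (z i - y) * \prod_(j < m.+1 | j != i :> nat) (z j - y).
    rewrite big_mkcond big_ord_recr /= eqxx mulr1 [LHS](bigD1 i) //=.
    rewrite ltn_eqF; last exact: ltn_ord.
    congr (_ * _); rewrite [in RHS]big_mkcond [in LHS]big_mkcond /=.
    apply: eq_bigr => j _; rewrite -val_eqE /=; case: eqP => //= _.
    by rewrite ltn_eqF // ltn_ord.
  have -> : \prod_(j < m.+2 | j != i :> nat) (z j - y) =
            \prod_(j < m.+1 | j != i :> nat) (z j - y) * (z m.+1 - y).
    rewrite big_mkcond big_ord_recr /= gtn_eqF ?ltn_ord //=; congr (_ * _).
    by rewrite [RHS]big_mkcond.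
  have d0 : z i - z m.+1 != 0 by rewrite subr_eq0 gt_eqF // zltm // -ltnS ltn_ord.
  by rewrite /w; field.
- by rewrite leq0n mu0 big_ord_recr.
Qed.

(* The last bound gives [mu 0 >= (1 - c) / 2] in [interlacing_weights]; this
   sharper form is what the induction, from [m] to [m + 2], can carry. *)
Lemma exists_interlacing {R : realFieldType} (z : nat -> R) (c : R) (m : nat) :
  c < 1 -> z 0%N = 1 -> (forall i j, (i < j <= m)%N -> z j < z i) ->
  exists r : nat -> R,
    [/\ forall k, (k < m)%N -> z k.+1 <= r k <= z k,
        forall y, y <= c -> 0 <= \prod_(k < m) (r k - y)
      & (if c <= z m then 1 else (1 - c) / (1 - z m)) *
          \prod_(k < m) (1 - z k.+1) <= \prod_(k < m) (1 - r k)].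
Proof.
move=> c1 z0; elim/ltn_ind: m => -[|m] IH zdec.
  exists z; split=> [//|y yc|]; rewrite !big_ord0 ?ler01 // z0 (ltW c1).
  by rewrite mulr1.
have zltm i : (i <= m)%N -> z m.+1 < z i.
  by move=> im; apply: zdec; rewrite ltnS im leqnn.
have zlem i : (i <= m)%N -> z m <= z i.
  by rewrite leq_eqVlt => /predU1P[->//|im]; apply/ltW/zdec; rewrite im leqnSn.
have z1 i : (i <= m)%N -> z i.+1 < 1 by move=> im; rewrite -z0; apply: zdec.
have [czm|zmc] := leP c (z m).
  (* Here every [r k] can be taken at least [c], so each factor is nonnegative for [y <= c]. *)
  exists (fun k => if k == m then Num.max c (z m.+1) else z k.+1); split.
  - move=> k; rewrite ltnS => km; case: eqP => [->|/eqP nkm].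
      by rewrite le_max lexx orbT ge_max czm ltW // zltm.
    by rewrite lexx ltW // zdec // ltnSn ltnS.
  - move=> y yc; apply: prodr_ge0 => k _; rewrite subr_ge0 (le_trans yc) //.
    case: eqP => [_|/eqP nkm]; first by rewrite le_max lexx.
    by rewrite (le_trans czm) // zlem // ltn_neqAle nkm -ltnS ltn_ord.
  - rewrite !big_ord_recr /= eqxx.
    under [X in _ <= X * _]eq_bigr => k _ do rewrite ltn_eqF ?ltn_ord //.
    rewrite mulrCA; case: (leP c (z m.+1)) => h; first by rewrite mul1r.
    by rewrite divfK // subr_eq0 gt_eqF // z1.
case: m IH zdec zltm zlem z1 zmc => [|m] IH zdec zltm zlem z1 zmc.
  by move: zmc; rewrite z0; lra.
have [||r [r1 r2 r3]] := IH m.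
- exact: leqW.
- by move=> i j /andP[ij jm]; apply: zdec; rewrite ij !leqW.
(* Now [z m.+1 < c]. The last two points coincide at [z m.+1], which lies between its two
   neighbours; their factors form a square, and the first [m] points come from the induction
   hypothesis. *)
exists (fun k => if (k < m)%N then r k else z m.+1); split.
- move=> k; case: (ltnP k m) => [km _|mk]; first exact: r1.
  rewrite ltnS leq_eqVlt => /predU1P[->|km]; first by rewrite lexx ltW // zltm.
  have /eqP-> : k == m by rewrite eqn_leq mk -ltnS km.
  by rewrite lexx ltW // zdec // ltnSn leqnSn.
- move=> y yc; rewrite !big_ord_recr /= ltnn ltnNge leqnSn /=.
  under eq_bigr => k _ do rewrite ltn_ord.
  by rewrite -mulrA mulr_ge0 ?r2 // -expr2 sqr_ge0.
rewrite !big_ord_recr /= ltnn ltnNge leqnSn /=.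
under [X in _ <= X * _ * _]eq_bigr => k _ do rewrite ltn_ord.
have zm2 : z m.+2 < c by apply: lt_trans zmc; apply: zltm.
rewrite [X in if X then _ else _]lt_geF //=.
set A := \prod_(_ < m) _ in r3 *; set B := \prod_(_ < m) _ in r3 *.
have A0 : 0 <= A by apply: prodr_ge0 => k _; rewrite subr_ge0 ltW // z1 // leqW // ltnW.
have h1 := z1 m (leqnSn _); have h2 := z1 m.+1 (leqnn _).
have -> : (1 - c) / (1 - z m.+2) * (A * (1 - z m.+1) * (1 - z m.+2)) =
    A * (1 - c) * (1 - z m.+1).
  by field; rewrite subr_eq0 gt_eqF.
(* The factor [1 - z m.+2] has cancelled, and one factor [1 - z m.+1] is common to both sides. *)
suff h : A * (1 - c) <= B * (1 - z m.+1) by rewrite ler_wpM2r //; lra.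
case: (leP c (z m)) r3 => hc r3.
  by rewrite mul1r in r3; apply: ler_pM => //; lra.
have h3 : z m.+1 < z m by apply: zdec; rewrite ltnSn leqnSn.
apply: (@le_trans _ _ ((1 - c) / (1 - z m) * A * (1 - z m.+1))); last by rewrite ler_wpM2r //; lra.
have h4 : 1 <= (1 - z m.+1) / (1 - z m) by rewrite ler_pdivlMr; lra.
have -> : (1 - c) / (1 - z m) * A * (1 - z m.+1) =
    A * (1 - c) * ((1 - z m.+1) / (1 - z m)) by ring.
by rewrite ler_peMr // mulr_ge0 //; lra.
Qed.

(** * Factoring out the sign changes *)

(** Roots in [-1, 1] are divided out one at a time. A root at 1 or -1 goes into [q], since [1 - 'X]
    and ['X + 1] are nonnegative there; an interior root met a second time leaves [s], and its
    square goes into [q]. Without roots in [-1, 1], the intermediate value theorem gives a constant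
    sign. *)
Lemma signed_factorization {R : rcfType} (p : {poly R}) :
  exists (s : seq R) (q : {poly R}) (b : bool),
    [/\ uniq s, forall x, x \in s -> -1 < x < 1,
        forall y, -1 <= y <= 1 -> 0 <= q.[y]
      & p = (-1) ^+ b *: (\prod_(x <- s) (x%:P - 'X) * q)].
Proof.
have [N] := ubnP (size p); elim: N p => // N IH p /ltnSE pN.
have [->|p0] := eqVneq p 0.
  exists [::], 0, false; split=> // [y _|]; first by rewrite horner0.
  by rewrite mulr0 scaler0.
have [[r r1 /factor_theorem[p' pE]]|noroot] :=
    pselect (exists2 r, -1 <= r <= 1 & root p r); last first.
  have sgn (f : {poly R}) : (forall y, -1 <= y <= 1 -> ~~ root f y) ->
      0 <= f.[-1] -> forall y, -1 <= y <= 1 -> 0 <= f.[y].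
    move=> nr f1 y /andP[y1 y2]; rewrite leNgt; apply/negP => fy.
    have [|x /andP[x1 x2]] := @poly_ivt R (- f) (-1) y y1.
      by rewrite !hornerN !oppr_ge0 !oppr_le0 f1 ltW.
    by rewrite rootN; apply/negP/nr; rewrite x1 (le_trans x2).
  have nr y : -1 <= y <= 1 -> ~~ root p y by move=> h; apply/negP => h'; apply: noroot; exists y.
  exists [::]; case: (leP 0 p.[-1]) => h.
    exists p, false; split=> //; first exact: (sgn _ nr h).
    by rewrite big_nil mul1r scale1r.
  exists (- p), true; split=> //; last by rewrite big_nil mul1r expr1 scaleN1r opprK.
  by apply: sgn => [y /nr|]; rewrite ?rootN // hornerN oppr_ge0 ltW.
have [|s [q [b [us sI q0 p'E]]]] := IH p'.
  have p'0 : p' != 0 by apply: contraNneq p0 => h; rewrite pE h mul0r.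
  by rewrite (leq_trans _ pN) // pE size_mul ?polyXsubC_eq0 // size_XsubC addn2.
have [rE|rn1] := eqVneq r 1.
  exists s, (q * (1 - 'X)), (~~ b); split=> //.
    by move=> y y1; rewrite hornerM mulr_ge0 ?q0 // !hornerE subr_ge0; case/andP: y1.
  rewrite pE p'E rE -!mul_polyC; case: (b); rewrite /= ?expr0 ?expr1; ring.
have [rE|rnN1] := eqVneq r (-1).
  exists s, (q * ('X + 1)), b; split=> //.
    move=> y y1; rewrite hornerM mulr_ge0 ?q0 // !hornerE.
    by case/andP: y1; lra.
  rewrite pE p'E rE -!mul_polyC; case: (b); rewrite /= ?expr0 ?expr1; ring.
have rI : -1 < r < 1 by move: r1; rewrite !le_eqVlt eq_sym (negPf rn1) (negPf rnN1).
have [rs|rs] := boolP (r \in s); last first.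
  exists (r :: s), q, (~~ b); split=> //; first by rewrite /= rs us.
    by move=> x; rewrite inE => /predU1P[->|/sI].
  rewrite big_cons pE p'E -!mul_polyC; case: (b); rewrite /= ?expr0 ?expr1; ring.
exists (rem r s), (q * ('X - r%:P) ^+ 2), (~~ b); split.
- exact: rem_uniq.
- by move=> x /mem_rem /sI.
- by move=> y y1; rewrite hornerM mulr_ge0 ?q0 // horner_exp sqr_ge0.
- rewrite pE p'E (perm_big _ (perm_to_rem rs)) big_cons -!mul_polyC.
  by case: (b); rewrite /= ?expr0 ?expr1; ring.
Qed.

Lemma node_factorization {R : rcfType} (p : {poly R}) :
  exists (z : nat -> R) (m : nat) (q : {poly R}),
    [/\ z 0%N = 1, forall i, (i <= m)%N -> -1 <= z i <= 1,
        forall i j, (i < j <= m)%N -> z j < z i,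
        forall y, -1 <= y <= 1 -> 0 <= q.[y]
      & (1 - 'X ^+ 2) * p = - (\prod_(j < m.+1) ((z j)%:P - 'X) * q)].
Proof.
have [s [q [b [us sI q0 ->]]]] := signed_factorization p.
(* The sign is adjusted at -1: [1 - 'X ^+ 2] is [(1 - 'X) * ('X + 1)], or [- (1 - 'X) * (-1 - 'X)].
   So the factor at -1 either joins [q] or makes -1 a further node, whichever leaves the required
   minus sign. *)
pose s' := if b then s else -1 :: s.
have s'I x : x \in s' -> -1 <= x < 1.
  have h y : y \in s -> -1 <= y < 1 by move=> /sI /andP[/ltW -> ->].
  rewrite /s'; case: (b) => [/h//|]; rewrite inE => /predU1P[->|/h//].
  by rewrite lexx; lra.
have us' : uniq s'.
  by rewrite /s'; case: (b) => //=; rewrite us andbT; apply/negP => /sI; rewrite ltxx.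
pose q' := if b then q * ('X + 1) else q.
pose l := rev (rcons (sort <=%O s') 1).
have lI x : x \in l -> -1 <= x <= 1.
  rewrite mem_rev mem_rcons inE mem_sort => /predU1P[->|/s'I/andP[-> /ltW->]//].
  by rewrite lexx andbT; lra.
have lsort : sorted >%O l.
  rewrite /l rev_sorted -[sorted _ _]/(sorted <%O _) lt_sorted_pairwise pairwise_rcons.
  rewrite -lt_sorted_pairwise sort_lt_sorted us' andbT.
  by apply/allP => x; rewrite mem_sort => /s'I /andP[].
have sizel : size l = (size s').+1 by rewrite size_rev size_rcons size_sort.
exists (nth 0 l), (size s'), q'; split.
- by rewrite /l rev_rcons.
- by move=> i im; apply/lI/mem_nth; rewrite sizel ltnS.
- move=> i j /andP[ij jm]; have jl : (j < size l)%N by rewrite sizel ltnS.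
  apply: (sorted_ltn_nth _ 0 lsort) => //; last by rewrite inE (ltn_trans ij).
  by move=> x y w yx xw; exact: lt_trans xw yx.
- rewrite /q'; case: (b) => // y y1; rewrite hornerM mulr_ge0 ?q0 // !hornerE.
  by case/andP: y1; lra.
- rewrite -sizel -(big_mkord predT (fun j => (nth 0 l j)%:P - 'X)).
  rewrite -(big_nth 0 predT (fun x => x%:P - 'X)).
  rewrite /l rev_rcons big_cons [X in _ * X * _](perm_big s') /=;
    last by rewrite perm_rev perm_sort.
  rewrite /q' /s'.
  case: (b); rewrite ?big_cons -?mul_polyC /= ?expr0 ?expr1; ring.
Qed.

Lemma roots_finite {R : idomainType} (p : {poly R}) :
  p != 0 -> exists s : seq R, forall x, root p x -> x \in s.
Proof.
have [N] := ubnP (size p); elim: N p => // N IH p /ltnSE pN p0.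
have [[r /factor_theorem[p' pE]]|noroot] := pselect (exists r, root p r); last first.
  by exists [::] => x px; case: noroot; exists x.
have p'0 : p' != 0 by apply: contraNneq p0 => h; rewrite pE h mul0r.
have [||s sP] := IH p'; [|by []|].
  by rewrite (leq_trans _ pN) // pE size_mul ?polyXsubC_eq0 // size_XsubC addn2.
exists (r :: s) => x; rewrite pE rootM root_XsubC inE => /orP[/sP->|->//].
by rewrite orbT.
Qed.

(** * Chebyshev polynomials and the nodes *)

Fixpoint chebT {R : comNzRingType} (m : nat) : {poly R} :=
  match m with
  | 0 => 1
  | 1 => 'X
  | (k.+1 as l).+1 => ('X * chebT l) *+ 2 - chebT k
  end.

(* Shifted by one: [chebU m] is the usual U_(m-1), with U_(-1) = 0. *)
Fixpoint chebU {R : comNzRingType} (m : nat) : {poly R} :=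
  match m with
  | 0 => 0
  | 1 => 1
  | (k.+1 as l).+1 => ('X * chebU l) *+ 2 - chebU k
  end.

(* The quotient (T_m(X) - T_m(x)) / (X - x). *)
Fixpoint chebT_quot {R : comNzRingType} (x : R) (m : nat) : {poly R} :=
  match m with
  | 0 => 0
  | 1 => 1
  | (k.+1 as l).+1 =>
      (x *: chebT_quot x l + chebT l) *+ 2 - chebT_quot x k
  end.

Lemma chebTS {R : comNzRingType} m :
  chebT m.+2 = ('X * chebT m.+1) *+ 2 - chebT m :> {poly R}.
Proof. by []. Qed.

Lemma chebUS {R : comNzRingType} m :
  chebU m.+2 = ('X * chebU m.+1) *+ 2 - chebU m :> {poly R}.
Proof. by []. Qed.

Lemma chebT_quotS {R : comNzRingType} (x : R) m :
  chebT_quot x m.+2 =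
    (x *: chebT_quot x m.+1 + chebT m.+1) *+ 2 - chebT_quot x m.
Proof. by []. Qed.

Lemma nat_ind2 (P : nat -> Prop) :
  P 0%N -> P 1%N -> (forall m, P m -> P m.+1 -> P m.+2) -> forall m, P m.
Proof.
move=> P0 P1 PS m; suff [] : P m /\ P m.+1 by [].
by elim: m => [|m [h1 h2]]; split=> //; exact: PS.
Qed.

Lemma chebT_quotP {R : comNzRingType} (x : R) m :
  chebT m = (chebT m).[x]%:P + chebT_quot x m * ('X - x%:P).
Proof.
elim/nat_ind2: m => [||m IH1 IH2].
- by rewrite /= mul0r addr0 hornerC.
- by rewrite /= mul1r hornerX addrC subrK.
- rewrite chebTS chebT_quotS hornerD hornerN hornerMn hornerM hornerX.
  rewrite polyCB polyCMn polyCM; move: IH1 IH2.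
  set t0 := (chebT m).[x]; set t1 := (chebT m.+1).[x] => -> ->.
  rewrite -!mul_polyC; ring.
Qed.

(** The polynomial form of cos mt - cos (m + 2)t = 2 sin t sin (m + 1)t. *)
Lemma chebTB {R : comNzRingType} m :
  chebT m - chebT m.+2 = ((1 - 'X ^+ 2) * chebU m.+1) *+ 2 :> {poly R}.
Proof.
elim/nat_ind2: m => [||m IH1 IH2].
- by rewrite /=; ring.
- by rewrite /=; ring.
- have -> : chebT m.+2 - chebT m.+4 =
      ('X * (chebT m.+1 - chebT m.+3)) *+ 2 - (chebT m - chebT m.+2) :> {poly R}.
    by rewrite (chebTS m.+2) (chebTS m); ring.
  by rewrite IH1 IH2 (chebUS m.+1); ring.
Qed.

(** The polynomial form of sin (m + 2)t - sin mt = 2 sin t cos (m + 1)t, divided by sin t. *)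
Lemma chebUB {R : comNzRingType} m :
  chebU m.+2 - chebU m = chebT m.+1 *+ 2 :> {poly R}.
Proof.
elim/nat_ind2: m => [||m IH1 IH2].
- by rewrite /=; ring.
- by rewrite /=; ring.
- have -> : chebU m.+4 - chebU m.+2 =
      ('X * (chebU m.+3 - chebU m.+1)) *+ 2 - (chebU m.+2 - chebU m) :> {poly R}.
    by rewrite (chebUS m.+2) (chebUS m); ring.
  by rewrite IH1 IH2 (chebTS m.+1); ring.
Qed.

Lemma horner_chebT_cos {R : realType} (t : R) m :
  (chebT m).[cos t] = cos (m%:R * t).
Proof.
elim/nat_ind2: m => [||m IH1 IH2].
- by rewrite mul0r cos0 hornerC.
- by rewrite mul1r hornerX.
- have -> : m.+2%:R * t = m.+1%:R * t + t by rewrite -[m.+2]addn1 natrD; ring.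
  have e : m%:R * t = m.+1%:R * t - t by rewrite -[m.+1]addn1 natrD; ring.
  rewrite e cosB in IH1.
  rewrite chebTS hornerD hornerN hornerMn hornerM hornerX IH1 IH2 cosD; ring.
Qed.

Lemma horner_chebU_cos {R : realType} (t : R) m :
  sin t * (chebU m).[cos t] = sin (m%:R * t).
Proof.
elim/nat_ind2: m => [||m IH1 IH2].
- by rewrite mul0r sin0 horner0 mulr0.
- by rewrite mul1r hornerC mulr1.
- have -> : m.+2%:R * t = m.+1%:R * t + t by rewrite -[m.+2]addn1 natrD; ring.
  have e : m%:R * t = m.+1%:R * t - t by rewrite -[m.+1]addn1 natrD; ring.
  rewrite e sinB in IH1.
  have -> : sin t * (chebU m.+2).[cos t] =
      (cos t * (sin t * (chebU m.+1).[cos t])) *+ 2 - sin t * (chebU m).[cos t].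
    by rewrite chebUS hornerD hornerN hornerMn hornerM hornerX; ring.
  rewrite IH1 IH2 sinD; ring.
Qed.

(** For [k <= n] these are the roots of T_(n+1) + 1 listed with multiplicity: those in (-1, 1) occur
    twice. *)
Definition node {R : realType} (n k : nat) : R := cos ((2 * k + 1)%:R * (pi / n.+1%:R)).

Definition node_sum {R : realType} (n : nat) (p : {poly R}) : R :=
  \sum_(k < n.+1) p.[node n k].

Lemma node_angle {R : realType} (n k : nat) : (k <= n.+1)%N ->
  0 <= k%:R * ((pi : R) / n.+1%:R) <= pi.
Proof.
move=> kn; rewrite mulr_ge0 ?divr_ge0 ?pi_ge0 //= mulrCA ler_piMr ?pi_ge0 //.
by rewrite ler_pdivrMr ?mul1r ?ler_nat.
Qed.

(** With a = pi / (n + 1), cos a - cos (2k + 1)a = 2 sin ka sin (k + 1)a, and both angles on the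
    right lie in [0, pi]. *)
Lemma node_le {R : realType} (n k : nat) : (k <= n)%N ->
  node n k <= cos ((pi : R) / n.+1%:R).
Proof.
move=> kn; have h := @sin_ge0_pi R _ (node_angle _ _ (leqW kn)).
have h' := @sin_ge0_pi R _ (node_angle _ k.+1 kn).
rewrite -subr_ge0 /node; set a := pi / _ in h h' *.
have -> : (2 * k + 1)%:R * a = k.+1%:R * a + k%:R * a.
  by rewrite -[k.+1]addn1 mul2n -addnn !natrD; ring.
have {1}-> : a = k.+1%:R * a - k%:R * a :> R by rewrite -[k.+1]addn1 !natrD; ring.
rewrite [cos (_ - _)]cosB cosD; have := mulr_ge0 h h'; lra.
Qed.

Lemma node_sum_chebT {R : realType} (n m : nat) : (m <= n)%N ->
  node_sum n (chebT m : {poly R}) = n.+1%:R * (m == 0%N)%:R.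
Proof.
rewrite /node_sum; case: m => [_|m mn].
  under eq_bigr do rewrite hornerC.
  by rewrite sumr_const card_ord mulr1.
rewrite mulr0; set a : R := pi / n.+1%:R; set b := m.+1%:R * a.
have b0 : 0 < sin b.
  apply: sin_gt0_pi; rewrite /b /a mulr_gt0 ?divr_gt0 ?pi_gt0 //=.
  by rewrite mulrCA gtr_pMr ?pi_gt0 // ltr_pdivrMr // mul1r ltr_nat ltnS.
(* Multiplied by 2 sin b, the sum of the cos (2k + 1)b telescopes to sin 2(n + 1)b, and 2(n + 1)b is
   a multiple of 2 pi. *)
apply/(mulfI (lt0r_neq0 b0))/(mulfI (_ : 2 != 0 :> R)); first by rewrite pnatr_eq0.
rewrite mulr0 mulr0 -[RHS](_ : sin ((2 * n.+1)%:R * b) - sin ((2 * 0)%:R * b) = 0).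
  rewrite -(@telescope_sumr R 0 n.+1 (fun k => sin ((2 * k)%:R * b))) // big_mkord !mulr_sumr.
  apply: eq_bigr => k _; rewrite horner_chebT_cos.
  have -> : m.+1%:R * ((2 * k + 1)%:R * (pi / n.+1%:R)) = (2 * k)%:R * b + b.
    by rewrite natrD /b /a; ring.
  have -> : (2 * k.+1)%:R * b = (2 * k)%:R * b + b + b.
    by rewrite mulnS addnC natrD; ring.
  have -> : sin ((2 * k)%:R * b) = sin ((2 * k)%:R * b + b - b) by rewrite addrK.
  rewrite [sin (_ - b)]sinB [sin (_ + b + b)]sinD; ring.
have -> : (2 * n.+1)%:R * b = 0 + pi *+ 2 *+ m.+1.
  rewrite /b /a natrM add0r -mulrnA -[pi *+ _]mulr_natl natrM.
  by field; rewrite addrC natr1 pnatr_eq0.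
by rewrite (periodicn (@sinD2pi R)) muln0 mul0r sin0 subrr.
Qed.

(** The recurrences of [chebT_quot] and [chebU] differ by a term in [chebT]. For positive degree up
    to [n] its node sum vanishes, and in degree 0 it gives the initial value. *)
Lemma node_sum_quot {R : realType} (n m : nat) (x : R) : (m <= n.+1)%N ->
  node_sum n (chebT_quot x m) = n.+1%:R * (chebU m).[x].
Proof.
elim/nat_ind2: m => [||m IH1 IH2] mn.
- by rewrite /node_sum horner0 mulr0 big1 // => k _; rewrite horner0.
- by rewrite -[chebT_quot x 1]/(chebT 0) node_sum_chebT // hornerC.
- have E : node_sum n (chebT_quot x m.+2) = 2 * (x * node_sum n (chebT_quot x m.+1) +
      node_sum n (chebT m.+1)) - node_sum n (chebT_quot x m).
    rewrite /node_sum -sumrN mulr_sumr -big_split mulr_sumr -big_split.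
    apply: eq_bigr => k _.
    by rewrite chebT_quotS hornerD hornerN hornerMn hornerD hornerZ mulr_natl.
  rewrite E node_sum_chebT // IH2 ?(ltnW mn) // IH1 ?(leq_trans _ mn) 1?ltnW //.
  by rewrite mulr0 chebUS hornerD hornerN hornerMn hornerM hornerX; ring.
Qed.

(* [sin t * trigS a t] and [trigC a t] as polynomials in [cos t]. *)
Definition trigS_poly {R : realType} {n : nat} (a : 'rV[R]_n) : {poly R} :=
  (1 - 'X ^+ 2) * \sum_(j < n) a ord0 j *: chebU j.+1.

Definition trigC_poly {R : realType} {n : nat} (a : 'rV[R]_n) : {poly R} :=
  \sum_(j < n) a ord0 j *: chebT j.+1.

Lemma horner_trigS_poly {R : realType} (n : nat) (a : 'rV[R]_n) (t : R) :
  (trigS_poly a).[cos t] = sin t * trigS a t.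
Proof.
rewrite /trigS_poly /trigS !hornerE -sin2cos2 expr2 -mulrA; congr (_ * _).
rewrite horner_sum mulr_sumr; apply: eq_bigr => j _.
by rewrite hornerZ mulrCA horner_chebU_cos.
Qed.

Lemma horner_trigC_poly {R : realType} (n : nat) (a : 'rV[R]_n) (t : R) :
  (trigC_poly a).[cos t] = trigC a t.
Proof.
rewrite horner_sum; apply: eq_bigr => j _.
by rewrite hornerZ horner_chebT_cos.
Qed.

(** By [chebTB], [trigS_poly a] is a combination of the [chebT j - chebT j.+2]. Their quotients have
    node sums given by [chebU j - chebU j.+2], which [chebUB] turns into [chebT j.+1]. The largest
    index [j.+2] is [n.+1], the limit of [node_sum_quot]. *)
Lemma node_sum_quotient {R : realType} (n : nat) (a : 'rV[R]_n) (x : R) (g : {poly R}) :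
  trigS_poly a = (x%:P - 'X) * g ->
  node_sum n g = n.+1%:R * (trigC_poly a).[x].
Proof.
move=> E.
have SE : trigS_poly a = \sum_(j < n) (a ord0 j / 2) *: (chebT j - chebT j.+2).
  rewrite /trigS_poly mulr_sumr; apply: eq_bigr => j _.
  by rewrite chebTB -scalerMnr scalerMnl -mulr_natr divfK ?pnatr_eq0 // scalerAr.
pose d j := chebT_quot x j - chebT_quot x j.+2.
have gE : g = - \sum_(j < n) (a ord0 j / 2) *: d j.
  have Xx : x%:P - 'X != 0 :> {poly R} by rewrite -opprB oppr_eq0 polyXsubC_eq0.
  apply: (mulfI Xx); rewrite -E SE.
  have S0 : (trigS_poly a).[x] = 0 by rewrite E !hornerE subrr mul0r.
  rewrite SE horner_sum in S0.
  rewrite mulrN -mulNr opprB mulr_sumr.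
  (* The constant terms left by [chebT_quotP] add up to the value at the root [x], which is 0. *)
  transitivity ((\sum_(j < n) ((a ord0 j / 2) *: (chebT j - chebT j.+2)).[x])%:P +
      \sum_(j < n) ('X - x%:P) * ((a ord0 j / 2) *: d j)); last by rewrite S0 add0r.
  rewrite rmorph_sum -big_split; apply: eq_bigr => j _; 
  rewrite hornerZ hornerD hornerN; move: (chebT_quotP x j) (chebT_quotP x j.+2).
  set t0 := (chebT j).[x]; set t2 := (chebT j.+2).[x] => -> ->.
  rewrite /d -!mul_polyC -[RHS]/((a ord0 j / 2 * (t0 - t2))%:P +
    ('X - x%:P) * ((a ord0 j / 2)%:P * (chebT_quot x j - chebT_quot x j.+2))).
  by rewrite !polyCM polyCB; ring.
rewrite gE /node_sum horner_sum.
have -> : \sum_(k < n.+1) (- \sum_(j < n) (a ord0 j / 2) *: d j).[node n k] =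
    - \sum_(j < n) (a ord0 j / 2) * node_sum n (d j).
  under eq_bigr do rewrite hornerN horner_sum.
  rewrite sumrN exchange_big; congr (- _); apply: eq_bigr => j _.
  by rewrite mulr_sumr; apply: eq_bigr => k _; rewrite hornerZ.
rewrite -sumrN mulr_sumr; apply: eq_bigr => j _.
have -> : node_sum n (d j) = node_sum n (chebT_quot x j) - node_sum n (chebT_quot x j.+2).
  by rewrite /node_sum -sumrN -big_split; apply: eq_bigr => k _; rewrite hornerD hornerN.
have jn := ltn_ord j; rewrite (node_sum_quot n j.+2) // (node_sum_quot n j) ?leqW ?(ltnW jn) //.
have e : (chebU j.+2).[x] - (chebU j).[x] = (chebT j.+1).[x] * 2.
  by rewrite -hornerN -hornerD chebUB hornerMn mulr_natr.
have -> : n.+1%:R * (a ord0 j *: chebT j.+1).[x] =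
    a ord0 j / 2 * (n.+1%:R * ((chebT j.+1).[x] * 2)) by rewrite hornerZ; field.
by rewrite -e; ring.
Qed.

(** * The upper bound *)

(** The factor sin t adds no zeros: S vanishes wherever sin t does. *)
Lemma trigS_eq0 {R : realType} {n : nat} (a : 'rV[R]_n) (t : R) :
  trigS a t = 0 <-> root (trigS_poly a) (cos t).
Proof.
rewrite rootE horner_trigS_poly mulf_eq0; split=> [->|/orP[/eqP s0|/eqP//]].
  by rewrite eqxx orbT.
by apply: big1 => j _; rewrite -horner_chebU_cos s0 mul0r mulr0.
Qed.

Lemma C_on_zeros_of_SE {R : realType} {n : nat} (a : 'rV[R]_n) (v : R) :
  C_on_zeros_of_S a v <->
  exists x, [/\ -1 <= x <= 1, root (trigS_poly a) x & v = (trigC_poly a).[x]].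
Proof.
split=> [[t /trigS_eq0 St <-]|[x [x1 Wx ->]]].
  exists (cos t); split=> //; last by rewrite horner_trigC_poly.
  by rewrite cos_geN1 cos_le1.
have xE : cos (acos x) = x by rewrite acosK // in_itv.
exists (acos x); last by rewrite -horner_trigC_poly xE.
by apply/trigS_eq0; rewrite xE.
Qed.

Lemma trigC_poly1 {R : realType} {n : nat} (a : 'rV[R]_n) :
  (trigC_poly a).[1] = \sum_(j < n) a ord0 j.
Proof.
rewrite -cos0 horner_trigC_poly; apply: eq_bigr => j _.
by rewrite mulr0 cos0 mulr1.
Qed.

Lemma root_trigS_poly1 {R : realType} {n : nat} (a : 'rV[R]_n) :
  root (trigS_poly a) 1.
Proof. by rewrite rootM; apply/orP; left; rewrite rootE !hornerE expr1n subrr. Qed.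

(** If the polynomial were 0, the quotient at the root 1 could be taken as 0, and
    [node_sum_quotient] would make the sum of the coefficients 0. *)
Lemma trigS_poly_neq0 {R : realType} {n : nat} (a : 'rV[R]_n) :
  \sum_(j < n) a ord0 j = 1 -> trigS_poly a != 0.
Proof.
move=> a1; apply/eqP => S0.
have := @node_sum_quotient R n a 1 0; rewrite S0 mulr0 trigC_poly1 a1 => /(_ erefl).
rewrite /node_sum big1 => [/esym/eqP|k _]; last by rewrite horner0.
by rewrite mulr1 pnatr_eq0.
Qed.

Lemma seq_has_min {R : realDomainType} (s : seq R) : s != [::] ->
  exists2 x, x \in s & forall y, y \in s -> x <= y.
Proof.
elim: s => // u s IH _; have [->|/IH[x xs xmin]] := eqVneq s [::].
  by exists u => [|y]; rewrite inE // => /eqP ->.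
have [ux|xu] := leP u x.
  exists u => [|y]; rewrite inE ?eqxx // => /predU1P[->//|/xmin].
  exact: le_trans.
exists x => [|y]; rewrite inE ?xs ?orbT // => /predU1P[->|/xmin//].
exact: ltW.
Qed.

(** The values are taken over the finitely many roots in [-1, 1], among which is 1. *)
Lemma C_on_zeros_has_min {R : realType} {n : nat} (a : 'rV[R]_n) :
  \sum_(j < n) a ord0 j = 1 -> exists m, is_min (C_on_zeros_of_S a) m.
Proof.
move=> /trigS_poly_neq0 /roots_finite[s sP].
pose good x := root (trigS_poly a) x && (-1 <= x <= 1).
have [|m] := @seq_has_min R [seq (trigC_poly a).[x] | x <- s & good x].
  apply/eqP => E; suff : (trigC_poly a).[1] \in ([::] : seq R) by [].
  rewrite -E map_f // mem_filter sP ?root_trigS_poly1 // /good root_trigS_poly1 lexx.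
  by rewrite andbT; lra.
case/mapP => x; rewrite mem_filter => /andP[/andP[Wx x1] _] mE mmin.
exists m; split; first by apply/C_on_zeros_of_SE; exists x.
move=> _ /C_on_zeros_of_SE[y [y1 Wy ->]]; apply/mmin/map_f.
by rewrite mem_filter sP // /good Wy y1.
Qed.

Lemma cos_pi_div_bounds {R : realType} (n : nat) : (1 <= n)%N ->
  -1 < cos ((pi : R) / n.+1%:R) < 1.
Proof.
move=> n1; set b := _ / _.
have b0 : 0 < b by rewrite divr_gt0 ?pi_gt0.
have b1 : b < pi by rewrite ltr_pdivrMr // ltr_pMr ?pi_gt0 // ltr1n.
have bI : b \in `[0, pi] by rewrite in_itv /= !ltW.
rewrite -cospi -cos0 !ltr_cos ?b0 ?b1 //; by rewrite in_itv /= ?lexx pi_ge0.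
Qed.

Lemma tan_half_sqr {R : realType} (n : nat) : (1 <= n)%N ->
  tan ((pi : R) / (2 * n.+1%:R)) ^+ 2 =
  (1 - cos (pi / n.+1%:R)) / (1 + cos (pi / n.+1%:R)).
Proof.
move=> n1; have /andP[c1 c2] := @cos_pi_div_bounds R n n1.
have E : pi / n.+1%:R = (pi / (2 * n.+1%:R)) *+ 2 :> R.
  by rewrite -mulr_natr; field; rewrite addrC natr1 pnatr_eq0.
rewrite E in c1 c2 *; rewrite cos_mulr2n in c1 c2 *.
rewrite /tan expr_div_n sin2cos2.
set u := cos _ in c1 c2 *; field.
by apply/andP; split; apply: contraTneq c1 => h; rewrite ?h; lra.
Qed.

Lemma min_upper_bound {R : realType} {n : nat} (a : 'rV[R]_n) (m : R) :
  (1 <= n)%N -> \sum_(j < n) a ord0 j = 1 -> is_min (C_on_zeros_of_S a) m ->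
  m <= - tan (pi / (2 * n.+1%:R)) ^+ 2.
Proof.
move=> n1 a1 [_ mlb]; rewrite tan_half_sqr //.
have := @cos_pi_div_bounds R n n1; set c := cos _ => /andP[c1 c2].
have [z [p [q [z0 zI zdec q0 WE]]]] :=
  node_factorization (\sum_(j < n) a ord0 j *: chebU j.+1).
rewrite -[LHS]/(trigS_poly a) in WE.
have [r [rz rpos rprod]] := exists_interlacing z c p c2 z0 zdec.
have [mu [mu0 mu1 muE mu0E]] := interlacing_weights z r p zdec rz.
pose g i := - (\prod_(j < p.+1 | j != i :> nat) ((z j)%:P - 'X) * q).
have gE (i : 'I_p.+1) : trigS_poly a = ((z i)%:P - 'X) * g i.
  by rewrite WE (bigD1 i) //= /g mulrN mulrA.
have Dz (i : 'I_p.+1) := node_sum_quotient n a (z i) (g i) (gE i).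
have sum_le0 : \sum_(i < p.+1) mu i * (trigC_poly a).[z i] <= 0.
  have : \sum_(i < p.+1) mu i * node_sum n (g i) <= 0.
    have -> : \sum_(i < p.+1) mu i * node_sum n (g i) =
        - \sum_(k < n.+1) (\prod_(l < p) (r l - node n k)) * q.[node n k].
      rewrite -sumrN; under eq_bigr do rewrite mulr_sumr.
      rewrite exchange_big; apply: eq_bigr => k _.
      rewrite muE mulr_suml -sumrN; apply: eq_bigr => i _.
      rewrite hornerN hornerM horner_prod mulrN mulrA; congr (- (_ * _ * _)).
      by apply: eq_bigr => j _; rewrite hornerD hornerN hornerC hornerX.
    rewrite oppr_le0; apply: sumr_ge0 => k _; apply: mulr_ge0.
      by apply: rpos; rewrite node_le // -ltnS.
    by rewrite q0 // cos_geN1 cos_le1.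
  under eq_bigr do rewrite Dz mulrCA.
  by rewrite -mulr_sumr pmulr_rle0.
have mD (i : nat) : (i <= p)%N -> m <= (trigC_poly a).[z i].
  move=> ip; apply: mlb; apply/C_on_zeros_of_SE; exists (z i); split=> //.
    exact: zI.
  by rewrite (gE (Ordinal (ip : (i < p.+1)%N))) rootM rootE !hornerE subrr eqxx.
(* The factor in [rprod] is 1 or [(1 - c) / (1 - z p)], and [z p >= -1]; either way it is at least
   [(1 - c) / 2]. *)
have mu0_ge : (1 - c) / 2 <= mu 0%N.
  have zp k : (k < p)%N -> 0 < 1 - z k.+1.
    by move=> kp; rewrite subr_gt0 -z0 zdec.
  have Z0 : 0 < \prod_(k < p) (1 - z k.+1) by apply: prodr_gt0 => k _; apply: zp.
  rewrite mu0E z0 prodf_div ler_pdivlMr //; apply: le_trans rprod.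
  rewrite ler_pM2r //; have /andP[zp1 _] := zI p (leqnn _).
  case: (leP c (z p)) => h; first lra.
  by rewrite ler_pM2l ?subr_gt0 // lef_pV2 ?posrE //; lra.
have m_le : mu 0%N + (1 - mu 0%N) * m <= 0.
  apply: le_trans sum_le0; rewrite big_ord_recl z0 trigC_poly1 a1 mulr1 lerD2l.
  have -> : 1 - mu 0%N = \sum_(i < p) mu (lift ord0 i).
    by rewrite -mu1 big_ord_recl addrC addKr.
  rewrite mulr_suml.
  by apply: ler_sum => i _; rewrite ler_wpM2l // mD //; exact: (ltn_ord i).
have mu_le1 : mu 0%N <= 1.
  by rewrite -mu1 big_ord_recl lerDl sumr_ge0.
rewrite -mulNr ler_pdivlMr; last lra.
(* For [m < 0] the left side of [m_le] increases with [mu 0], so [mu 0] may be replaced by its lower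
   bound; [m >= 0] would contradict [mu 0 > 0]. *)
have [m0|m0] := leP 0 m; last by nra.
have : 0 <= (1 - mu 0%N) * m by rewrite mulr_ge0 ?subr_ge0.
by lra.
Qed.

(** * Fejer's polynomial *)

(* The coefficients of [sin t * cos (m t)], and, read with cosines, of its
   conjugate. *)
Definition sin_cos_row {R : realType} (n m : nat) : 'rV[R]_n :=
  match m with
  | 0 => \row_j (j == 0%N :> nat)%:R
  | 1 => \row_j ((j == 1%N :> nat)%:R / 2)
  | k.+2 => \row_j (((j == k.+2 :> nat)%:R - (j == k :> nat)%:R) / 2)
  end.

Lemma sum_delta {R : pzRingType} (n m : nat) (f : nat -> R) : (m < n)%N ->
  \sum_(j < n) (j == m :> nat)%:R * f j = f m.
Proof.
move=> mn; rewrite (bigD1 (Ordinal mn)) //= eqxx mul1r big1 ?addr0 // => j jm.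
by rewrite -val_eqE /= in jm; rewrite (negPf jm) mul0r.
Qed.

Lemma sum_sin_cos_row {R : realType} (n m : nat) (f : nat -> R) : (m < n)%N ->
  \sum_(j < n) sin_cos_row n m ord0 j * f j =
  match m with 0 => f 0%N | 1 => f 1%N / 2 | k.+2 => (f k.+2 - f k) / 2 end.
Proof.
case: m => [|[|k]] mn.
- by under eq_bigr do rewrite mxE; rewrite sum_delta.
- under eq_bigr do rewrite mxE mulrAC.
  by rewrite -mulr_suml sum_delta.
- under eq_bigr do rewrite mxE mulrAC mulrBl.
  by rewrite -mulr_suml sumrB !sum_delta // ltnW // ltnW.
Qed.

Lemma trigS_sin_cos_row {R : realType} (n m : nat) (t : R) : (m < n)%N ->
  trigS (sin_cos_row n m) t = sin t * cos (m%:R * t).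
Proof.
move=> mn; rewrite /trigS (sum_sin_cos_row n m (fun j => sin (j.+1%:R * t)) mn).
case: m mn => [|[|k]] mn.
- by rewrite mul1r mul0r cos0 mulr1.
- by rewrite mul1r mulr_natl sin_mulr2n -mulr_natr mulfK ?pnatr_eq0 // mulrC.
- have -> : k.+3%:R * t = k.+2%:R * t + t by rewrite -[k.+3]addn1 natrD; ring.
  have -> : k.+1%:R * t = k.+2%:R * t - t by rewrite -[k.+2]addn1 natrD; ring.
  by rewrite sinB sinD; field.
Qed.

Lemma cos_natpi {R : realType} (k : nat) : cos (k%:R * pi) = (-1) ^+ k :> R.
Proof.
elim: k => [|k IH]; first by rewrite mul0r cos0.
by rewrite -[k.+1]addn1 natrD mulrDl mul1r cosDpi IH addn1 exprS mulN1r.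
Qed.

(** This is |k - l|: one of the two truncated differences is 0. *)
Definition natdist (k l : nat) : nat := (k - l + (l - k))%N.

Lemma cos_natdist {R : realType} (k l : nat) (t : R) :
  cos ((natdist k l)%:R * t) =
  cos (k%:R * t) * cos (l%:R * t) + sin (k%:R * t) * sin (l%:R * t).
Proof.
rewrite /natdist; wlog kl : k l / (k <= l)%N.
  move=> H; case/orP: (leq_total k l) => [/H//|/H].
  by rewrite addnC => ->; ring.
rewrite -cosB -cosN; congr cos.
by have -> : (k - l = 0)%N; [apply/eqP; rewrite subn_eq0 | rewrite add0n natrB //; ring].
Qed.

(** The sine coefficients of sin t |sum_k b_k e^(ikt)|^2, through the expansion of the square as the
    double sum of b_k b_l cos (k - l)t. *)
Definition fejer_row {R : realType} (n : nat) : 'rV[R]_n :=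
  \sum_(k < n) \sum_(l < n)
    (sin (k.+1%:R * (pi / n.+1%:R)) * sin (l.+1%:R * (pi / n.+1%:R))) *:
      sin_cos_row n (natdist k l).

Lemma natdist_lt n (k l : 'I_n) : (natdist k l < n)%N.
Proof.
rewrite /natdist; case/orP: (leq_total k l) => kl.
  have /eqP -> : (k - l == 0)%N by rewrite subn_eq0.
  by rewrite add0n (leq_ltn_trans (leq_subr _ _)).
have /eqP -> : (l - k == 0)%N by rewrite subn_eq0.
by rewrite addn0 (leq_ltn_trans (leq_subr _ _)).
Qed.

Lemma sum_fejer_row {R : realType} (n : nat) (f : nat -> R) :
  \sum_(j < n) fejer_row n ord0 j * f j =
  \sum_(k < n) \sum_(l < n)
    (sin (k.+1%:R * (pi / n.+1%:R)) * sin (l.+1%:R * (pi / n.+1%:R))) *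
      \sum_(j < n) sin_cos_row n (natdist k l) ord0 j * f j.
Proof.
under eq_bigr => j _.
  rewrite summxE mulr_suml.
  under eq_bigr => k _ do rewrite summxE mulr_suml.
  over.
rewrite [LHS]exchange_big /=; apply: eq_bigr => k _.
rewrite [LHS]exchange_big /=; apply: eq_bigr => l _.
by rewrite mulr_sumr; apply: eq_bigr => j _; rewrite mxE -[LHS]mulrA.
Qed.

Lemma trigS_fejer_row {R : realType} (n : nat) (t : R) :
  exists2 p, 0 <= p & trigS (fejer_row n) t = sin t * p.
Proof.
pose b k : R := sin (k.+1%:R * (pi / n.+1%:R)).
exists ((\sum_(k < n) b k * cos (k%:R * t)) ^+ 2 +
        (\sum_(k < n) b k * sin (k%:R * t)) ^+ 2).
  by rewrite addr_ge0 ?sqr_ge0.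
rewrite /trigS (sum_fejer_row n (fun j => sin (j.+1%:R * t))).
rewrite !expr2 !mulr_suml -big_split mulr_sumr; apply: eq_bigr => k _.
rewrite !mulr_sumr -big_split mulr_sumr; apply: eq_bigr => l _.
have := @trigS_sin_cos_row R n _ t (natdist_lt n k l); rewrite /trigS => ->.
rewrite cos_natdist -/(b k) -/(b l) /=; ring.
Qed.

(* With [b_k = sin ((k + 1) alpha)] and [alpha = pi / (n + 1)], this is
   [b_(k-1) + b_(k+1) = 2 cos alpha b_k], where [b_(-1) = b_n = 0]. *)
Lemma sum_sin_neighbours {R : realType} (n k : nat) : (k < n)%N ->
  \sum_(l < n) (natdist k l == 1%N)%:R * sin (l.+1%:R * ((pi : R) / n.+1%:R)) =
  2 * cos (pi / n.+1%:R) * sin (k.+1%:R * (pi / n.+1%:R)).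
Proof.
move=> kn; set al := pi / _.
pose b k : R := sin (k.+1%:R * al).
have E (l : 'I_n) : (natdist k l == 1%N)%:R = (l == k.+1 :> nat)%:R + (l.+1 == k)%:R :> R.
  by rewrite -natrD; congr (_%:R); rewrite /natdist; lia.
under eq_bigr => l _ do rewrite E mulrDl.
rewrite big_split /=.
have -> : \sum_(l < n) (l == k.+1 :> nat)%:R * sin (l.+1%:R * al) = b k.+1.
  have [kn1|] := ltnP k.+1 n; first exact: (sum_delta n k.+1 b).
  move=> nk; have nE : n = k.+1 by apply/eqP; rewrite eqn_leq nk kn.
  have -> : b k.+1 = 0.
    by rewrite /b /al -nE mulrC divfK ?pnatr_eq0 // sinpi.
  by apply: big1 => l _; rewrite -nE ltn_eqF // mul0r.
have -> : \sum_(l < n) (l.+1 == k)%:R * sin (l.+1%:R * al) = sin (k%:R * al).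
  case: k kn {E} => [|k] kn.
    by rewrite mul0r sin0 big1 // => l _; rewrite mul0r.
  exact: (sum_delta n k b (ltnW kn)).
have -> : k%:R * al = k.+1%:R * al - al by rewrite -[k.+1]addn1 natrD; ring.
rewrite /b; have -> : k.+2%:R * al = k.+1%:R * al + al by rewrite -[k.+2]addn1 natrD; ring.
by rewrite sinB sinD; ring.
Qed.

Lemma fejer_row_values {R : realType} (n : nat) : (1 <= n)%N ->
  exists2 B : R, 0 < B &
    trigC (fejer_row n) 0 = (cos (pi / n.+1%:R) + 1) * B /\
    trigC (fejer_row n) pi = (cos (pi / n.+1%:R) - 1) * B.
Proof.
move=> n1; pose b k : R := sin (k.+1%:R * (pi / n.+1%:R)).
exists (\sum_(k < n) b k ^+ 2).
  rewrite (bigD1 (Ordinal n1)) //= ltr_wpDr //.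
    by apply: sumr_ge0 => k _; exact: sqr_ge0.
  rewrite exprn_gt0 // /b mul1r sin_gt0_pi // divr_gt0 ?pi_gt0 //=.
  by rewrite ltr_pdivrMr // ltr_pMr ?pi_gt0 // ltr1n.
(* [f j] stands for cos (j + 1)t at t = 0 or t = pi, with [e] equal to 1 or -1. As [f] has period 2,
   the rows with [natdist k l >= 2] contribute 0, leaving the diagonal and the neighbours handled by
   [sum_sin_neighbours]. *)
have main (e : R) (f : nat -> R) : f 0%N = e -> f 1%N = 1 -> (forall k, f k.+2 = f k) ->
    \sum_(j < n) fejer_row n ord0 j * f j = (cos (pi / n.+1%:R) + e) * \sum_(k < n) b k ^+ 2.
  move=> f0 f1 fS; rewrite sum_fejer_row mulr_sumr; apply: eq_bigr => k _.
  transitivity (b k * (e * \sum_(l < n) (l == k :> nat)%:R * b l +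
      (\sum_(l < n) (natdist k l == 1%N)%:R * b l) / 2)).
    rewrite [e * _]mulr_sumr mulr_suml -big_split mulr_sumr; apply: eq_bigr => l _.
    rewrite sum_sin_cos_row ?natdist_lt // -/(b k) -/(b l).
    have -> : (l == k :> nat)%:R = (natdist k l == 0%N)%:R :> R.
      by congr (nat_of_bool _)%:R; rewrite /natdist; lia.
    by case: (natdist k l) => [|[|d]] /=; rewrite ?f0 ?f1 ?fS; ring.
  by rewrite sum_delta // sum_sin_neighbours // /b; field.
split.
- rewrite -(main 1 (fun=> 1)) //; apply: eq_bigr => j _.
  by rewrite mulr0 cos0.
- rewrite -(main (-1) (fun j => (-1) ^+ j.+1)) ?expr1 ?sqrrN ?expr1n //.
    by apply: eq_bigr => j _; rewrite cos_natpi.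
  by move=> k; rewrite [in LHS]exprS [in LHS]exprS; ring.
Qed.

Lemma fejer_perturbation {R : realType} (n : nat) (eps : R) :
  (1 <= n)%N -> 0 < eps ->
  exists (a : 'rV[R]_n) (m : R),
    [/\ \sum_(j < n) a ord0 j = 1, is_min (C_on_zeros_of_S a) m
      & - tan (pi / (2 * n.+1%:R)) ^+ 2 <= m + eps].
Proof.
move=> n1 eps0; rewrite tan_half_sqr //.
have := @cos_pi_div_bounds R n n1; have [B] := @fejer_row_values R n n1.
set c := cos _ => B0 [F0 Fpi] /andP[c1 c2].
have cB : 0 < (c + 1) * B by rewrite mulr_gt0 //; lra.
(* The perturbation is [eps] times the value of the Fejer cosine sum at 0, so the normalising
   constant [Z] is [(1 + eps) * ((c + 1) * B)]. *)
pose d := eps * ((c + 1) * B); have d0 : 0 < d by rewrite mulr_gt0.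
pose Z := (c + 1) * B + d; have Z0 : 0 < Z by rewrite addr_gt0.
pose a : 'rV[R]_n := Z^-1 *: (fejer_row n + d *: sin_cos_row n 0).
have lin (f : nat -> R) : \sum_(j < n) a ord0 j * f j =
    Z^-1 * (\sum_(j < n) fejer_row n ord0 j * f j + d * f 0%N).
  rewrite -(@sum_sin_cos_row R n 0 f n1) mulrDr !mulr_sumr -big_split.
  apply: eq_bigr => j _.
  have -> : a ord0 j = Z^-1 * (fejer_row n ord0 j + d * sin_cos_row n 0 ord0 j).
    by rewrite mxE [X in _ * X]mxE [X in _ + X]mxE.
  rewrite /=; ring.
have Ca t : trigC a t = Z^-1 * (trigC (fejer_row n) t + d * cos t).
  by rewrite /trigC (lin (fun j => cos (j.+1%:R * t))) mul1r.
have Sa t : trigS a t = Z^-1 * (trigS (fejer_row n) t + d * sin t).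
  by rewrite /trigS (lin (fun j => sin (j.+1%:R * t))) mul1r.
have C0 : trigC a 0 = 1 by rewrite Ca F0 cos0 mulr1 mulVf ?lt0r_neq0.
have Cpi : trigC a pi = ((c - 1) * B - d) / Z by rewrite Ca Fpi cospi mulrN1 mulrC.
have Cpi_le1 : trigC a pi <= 1.
  rewrite Cpi ler_pdivrMr // mul1r /Z.
  by have : (c - 1) * B <= (c + 1) * B; [rewrite ler_wpM2r //; lra | lra].
exists a, (trigC a pi); split.
- by rewrite -C0; apply: eq_bigr => j _; rewrite mulr0 cos0 mulr1.
- split.
    exists pi => //=; rewrite Sa sinpi mulr0 addr0.
    by have [p _ ->] := @trigS_fejer_row R n pi; rewrite sinpi mul0r mulr0.
  move=> _ [t /= St <-].
  (* S(t) is sin t times [(p + d) / Z] with [p >= 0] and [d > 0], so only the zeros of sin t remain,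
     where cos t is 1 or -1. *)
  have sint : sin t = 0.
    have [p p0 SE] := @trigS_fejer_row R n t.
    move: St; rewrite Sa SE [d * _]mulrC -mulrDr => /eqP.
    rewrite !mulf_eq0 invr_eq0 gt_eqF //= => /orP[/eqP//|].
    by rewrite gt_eqF // ltr_wpDl.
  have /eqP : cos t ^+ 2 = 1 by rewrite cos2sin2 sint expr0n subr0.
  rewrite sqrf_eq1 => /orP[] /eqP ct; rewrite -[leRHS]horner_trigC_poly ct.
    by rewrite -cos0 horner_trigC_poly C0.
  by rewrite -cospi horner_trigC_poly.
- rewrite Cpi -subr_ge0.
  have -> : ((c - 1) * B - d) / Z + eps - - ((1 - c) / (1 + c)) =
      eps * (eps * (1 + c) + (1 - c)) / ((1 + c) * (1 + eps)).
    have := lt0r_neq0 Z0; rewrite /Z /d => Zn0.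
    field; rewrite Zn0 andbT; apply/andP.
    by split; rewrite lt0r_neq0 //; lra.
  have ec : 0 <= eps * (1 + c) by rewrite mulr_ge0 //; lra.
  by rewrite divr_ge0 // mulr_ge0 //; lra.
Qed.

Theorem theorem2 (R : realType) (n : nat) (hn : (1 <= n)%N) :
  (forall a : 'rV[R]_n, \sum_(j < n) a ord0 j = 1 ->
     exists m : R, is_min (C_on_zeros_of_S a) m) /\
  J1 R n = (- tan (pi / (2 * (n.+1)%:R)) ^+ 2)%:E.
Proof.
split=> [a|]; first exact: C_on_zeros_has_min.
apply/eqP; rewrite eq_le; apply/andP; split.
  apply: ge_ereal_sup => _ [m [a [a1 am]] <-].
  by rewrite lee_fin (min_upper_bound a).
apply/lee_addgt0Pr => e e0.
have [a [m [a1 am me]]] := @fejer_perturbation R n e hn e0.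
apply: (@le_trans _ _ (m%:E + e%:E)%E); first by rewrite -EFinD lee_fin.
by rewrite leeD2r //; apply: ereal_sup_ubound; exists m => //; exists a.
Qed.
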